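(* Let $n\ge 1$ be an integer and let $K=\{123,132\}\{213,321\}$. The number of equivalence classes of $S_n$ under $K$-equivalence is $\sum_{i=0}^{n-1} M_i$, where $M_i$ denotes the $i$-th Motzkin number.
   Context: Permutations in $S_n$ are written as words $\pi_1\pi_2\cdots\pi_n$ in one-line notation. The order permutation of a word $u$ of $c$ distinct positive integers is the unique $\sigma\in S_c$ with $\sigma_i<\sigma_j$ iff $u_i<u_j$. A replacement partition $K$ of $S_c$ is a set partition of $S_c$; it is denoted by listing its parts with the one-element parts (and outer brackets) omitted, so here $K$ is the set partition of $S_3$ whose only parts of size greater than one are $\{123,132\}$ and $\{213,321\}$. The $K$-equivalence on $S_n$ is the equivalence relation generated by: $\phi\equiv\psi$ whenever $\phi=aub$ and $\psi=avb$ (concatenations) for some possibly empty words $a,b$ and words $u,v$ of length $c$ (so $u,v$ occupy the same $c$ consecutive positions) such that the order permutations of $u$ and $v$ lie in the same part of $K$. All equivalence classes are counted, including one-element classes. The Motzkin number $M_i$ ($i\ge 0$) is the number of lattice paths from $(0,0)$ to $(i,0)$ in $\mathbb{N}\times\mathbb{N}$ (with $0\in\mathbb{N}$, so paths never go below the horizontal axis) using only steps $(1,1)$, $(1,0)$ and $(1,-1)$; thus $M_0=1$, $M_1=1$, $M_2=2$, $M_3=4$. *)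

(* Defs.v *)
From mathcomp Require Import all_boot all_order all_fingroup all_algebra.
Set Implicit Arguments.
Unset Strict Implicit.
Unset Printing Implicit Defensive.
Import Order.TTheory GRing.Theory Num.Theory.

(* 'S_n acts on {0, ..., n-1}; the shift by one gives the usual one-line
   notation over the letters 1, ..., n. *)
Definition word n (p : 'S_n) : seq nat := [seq (p i).+1 | i <- enum 'I_n].

(* The equivalence also forces the letters of u to be pairwise distinct. *)
Definition is_order_perm c (u : seq nat) (s : 'S_c) : bool :=
  (size u == c) &&
  [forall i : 'I_c, forall j : 'I_c,
     (s i < s j) == (nth 0 u i < nth 0 u j)].

(* The elements of 'S_c not covered by the listed parts become one-element
   parts. *)
Definition with_singletons c (L : {set {set 'S_c}}) : {set {set 'S_c}} :=
  L :|: [set [set s] | s in ~: cover L].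

(* At position k the words split as a ++ u ++ b and a ++ v ++ b, where
   size u = size v = c is enforced by is_order_perm; see replacementP. *)
Definition replacement c (K : {set {set 'S_c}}) n : rel 'S_n :=
  fun phi psi =>
  [exists k : 'I_n.+1,
    [&& take k (word phi) == take k (word psi),
        drop (k + c) (word phi) == drop (k + c) (word psi) &
        [exists P in K, exists s in P, exists t in P,
           is_order_perm (take c (drop k (word phi))) s &&
           is_order_perm (take c (drop k (word psi))) t]]].

(* replacement is symmetric (replacement_sym), so its reflexive transitive closure is
   the equivalence relation it generates. *)
Definition Kequiv c (K : {set {set 'S_c}}) n : rel 'S_n :=
  connect (@replacement c K n).

Definition Kclasses c (K : {set {set 'S_c}}) n : {set {set 'S_n}} :=
  equivalence_partition (@Kequiv c K n) [set: 'S_n].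

Definition K_123_132__213_321 : {set {set 'S_3}} :=
  with_singletons
    [set [set s : 'S_3 | word s \in [:: [:: 1; 2; 3]; [:: 1; 3; 2]]];
         [set s : 'S_3 | word s \in [:: [:: 2; 1; 3]; [:: 3; 2; 1]]]].

(* A path to abscissa i has exactly i steps; the step (1, s - 1) is encoded
   by s : 'I_3. *)
Definition height (p : seq 'I_3) : int := (\sum_(s <- p) (s%:Z - 1))%R.

Definition is_motzkin_path (p : seq 'I_3) : bool :=
  all (fun k => (0 <= height (take k p))%R) (iota 0 (size p).+1) &&
  (height p == 0%R).

Definition motzkin (i : nat) : nat := #|[set p : i.-tuple 'I_3 | is_motzkin_path p]|.

Lemma size_word n (p : 'S_n) : size (word p) = n.
Proof. by rewrite size_map size_enum_ord. Qed.

Lemma replacementP c (K : {set {set 'S_c}}) n (phi psi : 'S_n) :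
  reflect (exists a u v b : seq nat,
             [/\ word phi = a ++ u ++ b, word psi = a ++ v ++ b &
                 exists P s t, [/\ P \in K, s \in P, t \in P,
                   is_order_perm u s & is_order_perm v t]])
          (replacement K phi psi).
Proof.
apply: (iffP existsP) => [[k /and3P[/eqP Ea /eqP Eb]]|].
  case/exists_inP=> P PK /exists_inP[s sP] /exists_inP[t tP] /andP[su tv].
  exists (take k (word phi)), (take c (drop k (word phi))),
    (take c (drop k (word psi))), (drop (k + c) (word phi)).
  split; last by exists P, s, t.
    by rewrite addnC -drop_drop cat_take_drop cat_take_drop.
  by rewrite Ea Eb addnC -drop_drop cat_take_drop cat_take_drop.
case=> a [u [v [b [E1 E2 [P [s [t [PK sP tP su tv]]]]]]]].
have ltan : size a < n.+1.
  by rewrite -(size_word phi) E1 size_cat ltnS leq_addr.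
have /eqP szu : size u == c by case/andP: su.
have /eqP szv : size v == c by case/andP: tv.
exists (Ordinal ltan); rewrite /= E1 E2 !take_size_cat // eqxx /=.
rewrite addnC -!drop_drop !drop_size_cat // eqxx /=.
rewrite !take_size_cat //.
apply/exists_inP; exists P => //; apply/exists_inP; exists s => //.
by apply/exists_inP; exists t => //; rewrite su.
Qed.

Lemma replacement_sym c (K : {set {set 'S_c}}) n : symmetric (@replacement c K n).
Proof.
move=> x y; apply/replacementP/replacementP => -[a [u [v [b [E1 E2 [P [s [t []]]]]]]]] *;
  by exists a, v, u, b; split=> //; exists P, t, s.
Qed.

Lemma Kequiv_equivalence c (K : {set {set 'S_c}}) n :
  equivalence_rel (@Kequiv c K n).
Proof.
apply/equivalence_relP; split=> [x|x y xy]; first exact: connect0.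
exact: (same_connect (sym_connect_sym (@replacement_sym c K n))).
Qed.

Lemma with_singletons_partition c (L : {set {set 'S_c}}) :
  partition L (cover L) -> partition (with_singletons L) [set: 'S_c].
Proof.
case/and3P=> _ /trivIsetP dL L0; apply/and3P; split.
- rewrite eqEsubset subsetT; apply/subsetP=> s _; apply/bigcupP.
  have [/bigcupP[B BL sB]|sL] := boolP (s \in cover L).
    by exists B => //; rewrite inE BL.
  exists [set s]; last exact: set11.
  by rewrite inE; apply/orP; right; apply: imset_f; rewrite inE.
- have dis s B : s \in ~: cover L -> B \in L -> [disjoint [set s] & B].
    rewrite inE disjoints1 => sL BL; apply: contra sL => sB.
    by apply/bigcupP; exists B.
  apply/trivIsetP=> A B; rewrite !inE.
  case/orP=> [AL|/imsetP[s sL ->]] /orP[BL|/imsetP[t tL ->]] AB.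
  + exact: dL.
  + by rewrite disjoint_sym dis.
  + exact: dis.
  + by rewrite disjoints1 inE; apply: contraNneq AB => ->.
- rewrite inE negb_or L0; apply/imsetP=> -[s _ /setP/(_ s)].
  by rewrite set11 inE.
Qed.

Lemma K_123_132__213_321_partition :
  partition K_123_132__213_321 [set: 'S_3].
Proof.
apply: with_singletons_partition.
set A := [set s : 'S_3 | _]; set B := [set s : 'S_3 | _].
have wE (s : 'S_3) : word s = [:: (s ord0).+1; (s (inord 1)).+1; (s (inord 2)).+1].
  rewrite /word !enum_ordSl /= enum_ord0 /=.
  by congr [:: _; (_ (s _)).+1; (_ (s _)).+1]; apply: val_inj; rewrite /= inordK.
have A0 : A != set0.
  apply/set0Pn; exists 1%g.
  by rewrite inE wE !perm1 !inordK.
have B0 : B != set0.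
  apply/set0Pn; exists (tperm ord0 (inord 1)).
  rewrite inE wE tpermL tpermR tpermD ?inordK //.
    by rewrite -val_eqE /= inordK.
  by rewrite -val_eqE /= !inordK.
have AB : [disjoint A & B].
  rewrite -setI_eq0; apply/eqP/setP=> s; rewrite !inE.
  by apply/negP=> /andP[/orP[]/eqP-> ].
apply/and3P; split=> //.
  apply/trivIsetP=> C D; rewrite !inE => /orP[]/eqP-> /orP[]/eqP->.
  - by rewrite eqxx.
  - by [].
  - by rewrite disjoint_sym.
  - by rewrite eqxx.
by rewrite !inE negb_or ![set0 == _]eq_sym A0.
Qed.

(* Main.v *)
Require Import Defs.
From mathcomp Require Import all_boot all_order all_fingroup all_algebra.
From mathcomp Require Import zify.
Set Implicit Arguments.
Unset Strict Implicit.
Unset Printing Implicit Defensive.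
Import Order.TTheory GRing.Theory Num.Theory.

(** Write infinity for the letter n + 1. Scan a word from left to right and keep
    a list of pairs (b_k, x_k), ..., (b_1, x_1), latest pair first. Here x_k is
    the smallest letter read so far; the letters that were read and do not occur
    in the list are called free. A letter larger than x_k leaves the list alone.
    When a new minimum y arrives, let m be the least free letter (infinity if
    there is none). If m < b_k the pair (m, y) is added; otherwise the whole list
    is replaced by the single pair (x_k, y). The entries of an empty list count
    as infinity, so that the first letter y yields (infinity, y).

    The final list, the state of the word, is a complete invariant of the class.

    - It is invariant (state_keqv). In abc ~ acb the letters b and c are larger
      than the current minimum, so neither changes the list. In bac ~ cba with b
      above the current minimum, the letter c is neither a new minimum nor the
      least free letter. With b below it, both sides contain two consecutive new
      minima b and a, which reset the list to the single pair (b, a)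
      (state_double_descent).
    - It is complete. Preceded by the letter infinity, a word is equivalent to
      b_1 x_1 b_2 x_2 ... b_k x_k followed by its free letters in any order
      (keqv_letters_state); erasing the largest letter infinity respects the
      equivalence (keqv_filter). Two facts suffice: the letters following a
      smaller letter x, all larger than x, can be permuted freely (keqv_above),
      and a descent m y slides to the left across letters larger than m
      (keqv_slide).

    The lists that occur are those with x_k < x_(k-1) < b_k < b_(k-1) for
    consecutive pairs, x_j < b_j, pairwise distinct letters and x_k = 1. Label
    each of the letters 2, ..., b_1 - 1 by an up step if it is some x_j, by a
    down step if it is some b_j, and by a flat step otherwise. The inequalities
    say exactly that this is a Motzkin path, of length b_1 - 2 with
    2 <= b_1 <= n + 1, and every Motzkin path of length less than n arises once
    (code_motzkin, code_inj, code_surj). *)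

(** * Words modulo the replacements *)

(** The equivalence on arbitrary words over nat that is generated by
    abc ~ acb and bac ~ cba for a < b < c, in any three consecutive positions. *)
Inductive keqv : seq nat -> seq nat -> Prop :=
| keqv_refl w : keqv w w
| keqv_sym v w : keqv v w -> keqv w v
| keqv_trans u v w : keqv u v -> keqv v w -> keqv u w
| keqv_acb p q a b c : a < b -> b < c ->
    keqv (p ++ [:: a, b, c & q]) (p ++ [:: a, c, b & q])
| keqv_bac p q a b c : a < b -> b < c ->
    keqv (p ++ [:: b, a, c & q]) (p ++ [:: c, b, a & q]).

Lemma keqv_cat p q u v : keqv u v -> keqv (p ++ u ++ q) (p ++ v ++ q).
Proof.
elim=> [w|w1 w2 _|w1 w2 w3 _ IH1 _ IH2|p' q' a b c ab bc|p' q' a b c ab bc].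
- exact: keqv_refl.
- exact: keqv_sym.
- exact: keqv_trans IH1 IH2.
- by rewrite -!catA !(catA p p') /=; apply: keqv_acb.
- by rewrite -!catA !(catA p p') /=; apply: keqv_bac.
Qed.

Lemma keqv_catl p u v : keqv u v -> keqv (p ++ u) (p ++ v).
Proof. by move/(keqv_cat p [::]); rewrite !cats0. Qed.

Lemma keqv_catr q u v : keqv u v -> keqv (u ++ q) (v ++ q).
Proof. exact: (@keqv_cat [::]). Qed.

Lemma keqv_cons x u v : keqv u v -> keqv (x :: u) (x :: v).
Proof. exact: (@keqv_catl [:: x]). Qed.

Lemma keqv_perm u v : keqv u v -> perm_eq u v.
Proof.
elim=> [w|w1 w2 _|w1 w2 w3 _ IH1 _ IH2|p q a b c _ _|p q a b c _ _] //.
- by rewrite perm_sym.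
- exact: perm_trans IH1 IH2.
- by rewrite perm_cat2l; apply/seq.permP=> f /=; lia.
- by rewrite perm_cat2l; apply/seq.permP=> f /=; lia.
Qed.

(** Erasing all letters from t on respects the equivalence: once c is erased, the
    two sides of a replacement coincide. *)
Lemma keqv_filter t u v : keqv u v ->
  keqv [seq z <- u | z < t] [seq z <- v | z < t].
Proof.
elim=> [w|w1 w2 _|w1 w2 w3 _ IH1 _ IH2|p q a b c ab bc|p q a b c ab bc].
- exact: keqv_refl.
- exact: keqv_sym.
- exact: keqv_trans IH1 IH2.
- rewrite !filter_cat /=; case: (ltnP c t) => [ct|tc]; last exact: keqv_refl.
  have -> : b < t by lia.
  have -> : a < t by lia.
  exact: keqv_acb.
- rewrite !filter_cat /=; case: (ltnP c t) => [ct|tc]; last exact: keqv_refl.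
  have -> : b < t by lia.
  have -> : a < t by lia.
  exact: keqv_bac.
Qed.

(** The descent m y moves to the left across letters larger than m, by
    c m y ~ m y c. *)
Lemma keqv_slide m y V : y < m -> all (ltn m) V ->
  keqv (V ++ [:: m; y]) [:: m, y & V].
Proof.
move=> ym; elim: V => [_|c V IH /= /andP[mc /IH{}IH]]; first exact: keqv_refl.
apply: keqv_trans (keqv_cons c IH) _; apply: keqv_sym.
exact: (@keqv_bac [::]).
Qed.

Lemma min_in U : U != [::] -> exists2 z, z \in U & forall u, u \in U -> z <= u.
Proof.
case: U => // u0 U0 _; set U := u0 :: U0.
exists (nth 0 (sort leq U) 0); first by rewrite -(mem_sort leq) mem_nth // size_sort.
move=> u; rewrite -(mem_sort leq) => /(nthP 0)[i ilt <-].
have s := sort_sorted leq_total U.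
by apply: (sorted_leq_nth leq_trans leqnn) => //; rewrite inE //; apply: leq_ltn_trans ilt.
Qed.

(** The inductive step of keqv_above: the least letter z of U can be brought
    directly behind x. The hypothesis is keqv_above for shorter words. *)
Lemma keqv_min_front k x U :
    (forall x U V, size U < k -> perm_eq U V -> uniq U -> all (ltn x) U ->
      keqv (x :: U) (x :: V)) ->
    U != [::] -> size U <= k -> uniq U -> all (ltn x) U ->
  exists z W, [/\ perm_eq U (z :: W), all (ltn z) W & keqv (x :: U) (x :: z :: W)].
Proof.
move=> IH U0 leUk uU xU; have [z zU zmin] := min_in U0; exists z.
suff [W UW xW] : exists2 W, perm_eq U (z :: W) & keqv (x :: U) (x :: z :: W).
  exists W; split=> //; move: uU; rewrite (perm_uniq UW) => /andP[zNW _].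
  apply/allP=> w wW; rewrite /= ltn_neqAle zmin ?(perm_mem UW) ?inE ?wW ?orbT // andbT.
  by apply: contraNneq zNW => ->.
  have xz : x < z by apply: (allP xU).
  (* If z is not the last letter, a shorter prefix is rearranged. *)
  have base p q : uniq (p ++ z :: q) -> all (ltn x) (p ++ z :: q) ->
      size (p ++ z :: q) <= k -> q != [::] ->
      keqv (x :: p ++ z :: q) (x :: z :: p ++ q).
    move=> + + + q0; rewrite -cat_rcons cat_uniq all_cat size_cat.
    move=> /andP[up _] /andP[ap _] sz.
    apply: (@keqv_catr q (x :: rcons p z) (x :: z :: p)); apply: IH => //.
      by move: sz; case: (q) q0 => //= *; lia.
    by rewrite -cats1 perm_sym (perm_catC [:: z]).
  clear U0; case/splitPr: zU leUk uU xU zmin => p q.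
  have [->|q0] := eqVneq q [::]; last first.
    move=> sz up ap _; exists (p ++ q); last exact: base.
    by rewrite perm_catC /= perm_cons perm_catC.
  case/lastP: p => [|p c] sz up ap zmin; first by exists [::] => //; exact: keqv_refl.
  move: up ap; rewrite cats1 rcons_uniq all_rcons => /andP[zNp up] /andP[_ ap].
  have zc u : u \in rcons p c -> z < u.
    move=> uin; rewrite ltn_neqAle zmin ?mem_cat ?uin // andbT.
    by apply: contraNneq zNp => ->.
  case/lastP: p => [|p d] in sz up ap zmin zNp zc *.
    exists [:: c] => //=; first by apply/seq.permP=> f /=; lia.
    apply/keqv_sym/(@keqv_acb [::] [::]) => //; apply: zc; exact: mem_head.
  (* If z is last, the two letters before it are put in decreasing order, and
     d c z ~ c z d moves z away from the end. *)
  have [d' [c' [cd' P]]] : exists d' c', c' < d' /\ perm_eq [:: d; c] [:: d'; c'].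
    have : d != c.
      move: up; rewrite !rcons_uniq mem_rcons inE negb_or eq_sym.
      by case/andP=> /andP[].
    case: ltngtP => // cd _; [exists c, d | exists d, c]; split=> //.
    by apply/seq.permP=> f /=; lia.
  have E1 : rcons (rcons (rcons p d) c) z = p ++ [:: d; c; z].
    by rewrite -!cats1 -!catA.
  have P1 : perm_eq (rcons (rcons p d) c) (p ++ [:: d'; c']).
    by rewrite -!cats1 -catA perm_cat2l.
  exists (p ++ [:: c'; d']).
    rewrite perm_rcons perm_cons.
    apply: perm_trans P1 _; rewrite perm_cat2l; apply/seq.permP=> f /=; lia.
  have zc' : z < c'.
    by apply: zc; rewrite (perm_mem P1) mem_cat !inE eqxx !orbT.
  apply: (@keqv_trans _ (x :: p ++ [:: d'; c'; z])).
    rewrite -cats1 -[_ :: _ ++ [:: _; _; _]]/((x :: p) ++ [:: d'; c'] ++ [:: z]) catA.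
    apply: (@keqv_catr [:: z] (x :: _)); apply: IH => //.
    by move: sz; rewrite !size_cat !size_rcons /=; lia.
  apply: (@keqv_trans _ (x :: p ++ [:: c'; z; d'])).
    by apply/keqv_sym/(@keqv_bac (x :: p)).
  have Pall : perm_eq (rcons (rcons (rcons p d) c) z) ((p ++ [:: c']) ++ z :: [:: d']).
    rewrite E1 -catA perm_cat2l (@perm_trans _ ([:: d'; c'] ++ [:: z])) //.
      by rewrite -[[:: d; c; z]]/([:: d; c] ++ [:: z]) perm_cat2r.
    by apply/seq.permP=> f /=; lia.
  rewrite -[[:: c'; z; d']]/([:: c'] ++ z :: [:: d']) catA.
  apply: keqv_trans (base _ _ _ _ _ _) _ => //.
  - by rewrite -(perm_uniq Pall) rcons_uniq zNp.
  - by rewrite -(perm_all _ Pall) all_rcons /= xz.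
  - by rewrite -(perm_size Pall) -cats1.
  - by rewrite -catA; exact: keqv_refl.
Qed.

(** Behind a letter x, letters larger than x may be permuted arbitrarily. The
    least of them is moved directly behind x, and the induction goes on behind
    that letter. *)
Lemma keqv_above x U V : perm_eq U V -> uniq U -> all (ltn x) U ->
  keqv (x :: U) (x :: V).
Proof.
have [k] := ubnP (size U); elim: k x U V => // k IH x U V leUk UV uU xU.
have [U0|U0] := eqVneq U [::].
  by move: UV; rewrite U0 perm_sym => /perm_nilP->; exact: keqv_refl.
have V0 : V != [::] by rewrite -size_eq0 -(perm_size UV) size_eq0.
have uV : uniq V by rewrite -(perm_uniq UV).
have xV : all (ltn x) V by rewrite -(perm_all _ UV).
have leVk : size V <= k by rewrite -(perm_size UV).
have [z [W [UW zW xzW]]] := keqv_min_front IH U0 leUk uU xU.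
have [y [Y [VY yY xyY]]] := keqv_min_front IH V0 leVk uV xV.
have WY : perm_eq (z :: W) (y :: Y) by rewrite -(permPl UW) -(permPr VY).
have zy : z = y.
  have := perm_mem WY z; have := perm_mem WY y; rewrite !inE !eqxx /=.
  case: eqVneq => //= _ /(allP zW) /= lt1 /esym/(allP yY) /= lt2.
  by have := ltn_trans lt1 lt2; rewrite ltnn.
rewrite {}zy in WY xzW zW UW *.
apply: keqv_trans xzW _; apply: keqv_trans (keqv_sym xyY); apply: keqv_cons.
apply: IH => //; first by rewrite -ltnS (leq_trans _ leUk) // (perm_size UW).
- by move: WY; rewrite perm_cons.
- by move: uU; rewrite (perm_uniq UW) => /andP[].
Qed.

(** * Scanning a word from left to right *)

(** The word b_1 x_1 ... b_k x_k attached to the list (b_k, x_k), ..., (b_1, x_1). *)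
Definition letters (S : seq (nat * nat)) : seq nat :=
  flatten (rev [seq [:: s.1; s.2] | s <- S]).

(** The latest pair; both components are inf when the list is empty. *)
Definition top inf (S : seq (nat * nat)) := head (inf, inf) S.

(** The least free letter of r, that is, the least letter of r outside the list
    S, or inf if there is none. *)
Definition least inf (S : seq (nat * nat)) (r : seq nat) : nat :=
  foldr minn inf [seq u <- r | u \notin letters S].

(** The new list when y is read after the letters r. *)
Definition update inf S r y :=
  if (top inf S).2 < y then S
  else let m := least inf S r in
    if m < (top inf S).1 then (m, y) :: S else [:: ((top inf S).2, y)].

Lemma update_above inf S r y : (top inf S).2 < y -> update inf S r y = S.
Proof. by rewrite /update => ->. Qed.

(** The list obtained by scanning a word. The argument r is the word read
    backwards, so that its head is the letter read last. *)
Fixpoint state inf (r : seq nat) : seq (nat * nat) :=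
  if r is y :: r' then update inf (state inf r') r' y else [::].

Lemma letters_cons b x S : letters ((b, x) :: S) = letters S ++ [:: b; x].
Proof. by rewrite /letters /= rev_cons flatten_rcons. Qed.

Lemma mem_letters_cons u b x S :
  (u \in letters ((b, x) :: S)) = [|| u == b, u == x | u \in letters S].
Proof. by rewrite letters_cons mem_cat !inE orbC orbA. Qed.

Lemma leastP inf S r : all (ltn^~ inf) r ->
  (least inf S r == inf) ||
  (least inf S r \in r) && (least inf S r \notin letters S).
Proof.
rewrite /least; elim: r => [|y r IH] /=; first by rewrite eqxx.
move=> /andP[yi /IH{}IH]; case: ifP => [yS|_] /=; last first.
  by case/orP: IH => [->//|/andP[lr ->]]; rewrite inE lr !orbT.
case: leqP => [_|lt]; first by rewrite mem_head yS orbT.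
by case/orP: IH => [->//|/andP[lr ->]]; rewrite inE lr !orbT.
Qed.

Lemma least_le inf S r u : u \in r -> u \notin letters S -> least inf S r <= u.
Proof.
rewrite /least => + uS; elim: r => // y r IH; rewrite inE => /orP[/eqP<-|/IH{}IH].
  by rewrite /= uS /= geq_minl.
by rewrite /=; case: ifP => // _ /=; rewrite geq_min IH orbT.
Qed.

Lemma le_least inf S r m :
  m <= inf -> (forall u, u \in r -> u \notin letters S -> m <= u) -> m <= least inf S r.
Proof.
rewrite /least => mi; elim: r => // y r IH H /=.
have {}IH : m <= foldr minn inf [seq u <- r | u \notin letters S].
  by apply: IH => u ur; apply: H; rewrite inE ur orbT.
by case: ifP => // yS; rewrite /= leq_min IH andbT H ?mem_head.
Qed.

Lemma least_le_top inf S r : least inf S r <= inf.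
Proof. by rewrite /least; elim: [seq _ <- _ | _] => //= y s; rewrite geq_min orbC => ->. Qed.

Lemma least_eq_mem inf S r1 r2 : r1 =i r2 -> least inf S r1 = least inf S r2.
Proof.
move=> E; apply/eqP; rewrite eqn_leq !le_least ?least_le_top // => u ur uS.
  by apply: least_le; rewrite // -E.
by apply: least_le; rewrite // E.
Qed.

Lemma state_cat inf q r1 r2 : perm_eq r1 r2 -> state inf r1 = state inf r2 ->
  state inf (q ++ r1) = state inf (q ++ r2).
Proof.
move=> P E; elim: q => //= y q ->; rewrite /update.
by rewrite (@least_eq_mem _ _ _ (q ++ r2)) // => u; rewrite !mem_cat (perm_mem P).
Qed.

(** The second component of the latest pair is the minimum of the letters read,
    and inf if there are none. *)
Lemma top_min inf r : all (ltn^~ inf) r ->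
  (forall u, u \in r -> (top inf (state inf r)).2 <= u) /\
  (top inf (state inf r)).2 \in inf :: r.
Proof.
elim: r => [|y r IH]; first by rewrite mem_head.
move=> /= /andP[yi /IH{IH}[IH1 IH2]]; rewrite /update.
set x := (top inf (state inf r)).2 in IH1 IH2 *.
have [xy|yx] := ltnP x y.
  rewrite -/x; split=> [u|]; last by move: IH2; rewrite !inE => /orP[]->; rewrite ?orbT.
  by rewrite inE => /orP[/eqP->|/IH1//]; apply: ltnW.
have H : (forall u, u \in y :: r -> y <= u) /\ y \in [:: inf, y & r].
  split=> [u|]; last by rewrite !inE eqxx orbT.
  by rewrite inE => /orP[/eqP->//|/IH1]; apply: leq_trans.
by case: ifP.
Qed.

Lemma letters_sub inf r : all (ltn^~ inf) r ->
  {subset letters (state inf r) <= inf :: r}.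
Proof.
elim: r => [|y r IH] //= /andP[yi ri].
have [_ xin] := top_min ri; have {}IH := IH ri; rewrite /update.
have sub : {subset inf :: r <= [:: inf, y & r]}.
  by move=> u; rewrite !inE => /orP[]->; rewrite ?orbT.
have yin : y \in [:: inf, y & r] by rewrite !inE eqxx orbT.
case: ifP => _; first by move=> u /IH/sub.
have := leastP (state inf r) ri; set m := least _ _ _ => mP.
case: ifP => _ u.
  rewrite mem_letters_cons => /or3P[/eqP->|/eqP->//|/IH/sub//].
  by case/orP: mP => [/eqP->|/andP[mr _]]; rewrite ?mem_head // sub // inE mr orbT.
by rewrite mem_letters_cons => /or3P[/eqP->|/eqP->|]//; apply: sub.
Qed.

(** * The state is invariant under the replacements *)

(** After two consecutive new minima y and z the list is reset: once y has been
    read, no free letter is smaller than the first component of the latest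
    pair. *)
Lemma state_double_descent inf r y z :
    uniq (y :: r) -> all (ltn^~ inf) (y :: r) ->
    y < (top inf (state inf r)).2 -> z < y ->
  state inf [:: z, y & r] = [:: (y, z)].
Proof.
move=> uyr /= /andP[yi ri] yx zy.
have [xmin xin] := top_min ri.
have xi : (top inf (state inf r)).2 <= inf.
  by move: xin; rewrite inE => /orP[/eqP->//|/(allP ri)/ltnW].
set S' := update _ _ r y.
have top2 : (top inf S').2 = y.
  by rewrite /S' /update ltnNge (ltnW yx) /=; case: ifP.
suff le : (top inf S').1 <= least inf S' (y :: r).
  by rewrite /update top2 ltnNge (ltnW zy) /= ltnNge le.
have ynr : y \notin r by case/andP: uyr.
rewrite {1}/S' /S' /update ltnNge (ltnW yx) /=.
have := leastP (state inf r) ri; set m := least _ _ _ => mP.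
have mi : m <= inf.
  by case/orP: mP => [/eqP->//|/andP[/(allP ri)/ltnW]].
case: ifP => [_|_]; apply: le_least => //= u; rewrite inE mem_letters_cons !negb_or.
  move=> /orP[/eqP->|ur /and3P[_ _ uS]]; first by rewrite eqxx andbF.
  exact: least_le.
by move=> /orP[/eqP->|/xmin//]; rewrite eqxx andbF.
Qed.

Lemma state_acb inf a b c r : all (ltn^~ inf) [:: c, b, a & r] ->
  a < b -> b < c -> state inf [:: c, b, a & r] = state inf [:: b, c, a & r].
Proof.
move=> /= /andP[_ /andP[_ /andP[ai ri]]] ab bc.
have ari : all (ltn^~ inf) (a :: r) by rewrite /= ai.
have [/(_ a (mem_head _ _)) + _] := top_min ari.
rewrite -/(state inf (a :: r)); set S := state inf (a :: r) => ax.
by rewrite !(@update_above _ S) // (leq_ltn_trans ax) // (ltn_trans ab).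
Qed.

Lemma state_bac inf a b c r : uniq [:: c, a, b & r] -> all (ltn^~ inf) [:: c, a, b & r] ->
  a < b -> b < c -> state inf [:: c, a, b & r] = state inf [:: a, b, c & r].
Proof.
move=> uw /= /andP[ci /andP[ai /andP[bi ri]]] ab bc.
have ac := ltn_trans ab bc.
have [xmin xin] := top_min ri.
have [ubr ucr] : uniq (b :: r) /\ uniq (b :: c :: r).
  by move: uw => /=; rewrite !inE !negb_or; case/and4P=> /and3P[_ _ ->] _ -> ->; rewrite ltn_eqF.
have xE : (top inf (state inf r)).2 != b.
  move: xin; rewrite inE => /orP[/eqP->|]; first by rewrite gtn_eqF.
  by apply: contraTneq => ->; case/andP: ubr.
have keep := update_above.
case: (ltngtP (top inf (state inf r)).2 b) xE => // [xb|bx] _.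
  have xc := ltn_trans xb bc.
  rewrite (keep _ (state inf r) r b) // (keep _ (state inf r) r c) // (keep _ _ (c :: r) b) //.
  set S := state inf r in xmin xin xb xc *.
  have bS : b \notin letters S.
    apply: contraL ubr => /(letters_sub ri); rewrite inE ltn_eqF //= => -> //.
  (* Since b is free, the larger letter c is not the least free letter. *)
  have lst : least inf S (b :: c :: r) = least inf S (b :: r).
    rewrite /least /= bS /=; case: ifP => _ //=.
    by rewrite minnA (minn_idPl (ltnW bc)).
  rewrite [update _ S _ a]/update [update _ S (b :: c :: r) a]/update lst.
  case: ifP => [xa|_]; first by rewrite keep.
  by case: ifP => _; rewrite keep.
have -> : update inf (update inf (state inf r) r b) (b :: r) a = [:: (b, a)].
  by apply: (state_double_descent ubr) => //=; rewrite bi.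
rewrite keep //; symmetry; apply: (@state_double_descent inf (c :: r)) => //=.
  by rewrite bi ci.
by rewrite /update; case: ifP => // _; case: ifP.
Qed.

Lemma state_keqv inf u v : uniq u -> all (ltn^~ inf) u -> keqv u v ->
  state inf (rev u) = state inf (rev v).
Proof.
move=> uu ui uv; elim: uv uu ui =>
  // [w1 w2 E IH|w1 w2 w3 E1 IH1 E2 IH2|p q a b c ab bc|p q a b c ab bc].
- by rewrite -(perm_uniq (keqv_perm E)) -(perm_all _ (keqv_perm E)) => u1 i1; rewrite IH.
- move=> u1 i1; rewrite IH1 // IH2 // -?(perm_uniq (keqv_perm E1)) //.
  by rewrite -(perm_all _ (keqv_perm E1)).
- move=> _ iw; rewrite -!(cat1s _ (_ :: _)) -!(cat1s _ q) !rev_cat -!catA.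
  have Pm : perm_eq [:: c, b, a & rev p] [:: b, c, a & rev p].
    by apply/seq.permP=> f /=; lia.
  have E : perm_eq (rev (p ++ [:: a, b, c & q])) (rev q ++ [:: c, b, a & rev p]).
    by rewrite -!(cat1s _ (_ :: _)) -!(cat1s _ q) !rev_cat -!catA perm_refl.
  apply: (state_cat _ Pm); apply: state_acb => //.
  by move: iw; rewrite -all_rev (perm_all _ E) all_cat => /andP[].
move=> uw iw; rewrite -!(cat1s _ (_ :: _)) -!(cat1s _ q) !rev_cat -!catA.
have Pm : perm_eq [:: c, a, b & rev p] [:: a, b, c & rev p].
  by apply/seq.permP=> f /=; lia.
have E : perm_eq (rev (p ++ [:: b, a, c & q])) (rev q ++ [:: c, a, b & rev p]).
  by rewrite -!(cat1s _ (_ :: _)) -!(cat1s _ q) !rev_cat -!catA perm_refl.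
apply: (state_cat _ Pm); apply: state_bac => //.
  by move: uw; rewrite -rev_uniq (perm_uniq E) cat_uniq => /and3P[].
by move: iw; rewrite -all_rev (perm_all _ E) all_cat => /andP[].
Qed.

(** * The state determines the class *)

(** The relation between consecutive pairs (b_(j+1), x_(j+1)) and (b_j, x_j) of a
    list: x_(j+1) < x_j < b_(j+1) < b_j. *)
Definition nested (s s' : nat * nat) := [&& s.2 < s'.2, s'.2 < s.1 & s.1 < s'.1].

(** The lists that arise from scanning words with distinct letters. *)
Definition valid S :=
  [&& sorted nested S, all (fun s : nat * nat => s.2 < s.1) S & uniq (letters S)].

Lemma uniq_letters_cons b x S :
  uniq (letters ((b, x) :: S)) =
  [&& b != x, b \notin letters S, x \notin letters S & uniq (letters S)].
Proof.
rewrite letters_cons (perm_uniq (permEl (perm_catC _ _))) /= inE negb_or.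
by rewrite -!andbA.
Qed.

Lemma top_min_mem inf r : uniq r -> all (ltn^~ inf) r -> r != [::] ->
  (top inf (state inf r)).2 \in r.
Proof.
case: r => // y r /= /andP[yr _] /andP[yi ri] _.
have [_] := @top_min inf (y :: r) (introT andP (conj yi ri)).
rewrite inE => /orP[/eqP E|//].
have [/(_ y (mem_head _ _)) + _] := @top_min inf (y :: r) (introT andP (conj yi ri)).
by rewrite E leqNgt yi.
Qed.

Lemma state_valid inf r : uniq r -> all (ltn^~ inf) r -> valid (state inf r).
Proof.
elim: r => // y r IH /= /andP[yr ur] /andP[yi ri].
have {IH} V := IH ur ri; rewrite /update.
have [xmin xin] := top_min ri.
have Ssub := letters_sub ri.
have yS : y \notin letters (state inf r).
  by apply: contra yr => /Ssub; rewrite inE ltn_eqF.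
set S := state inf r in V xmin xin Ssub yS *.
have xy : y != (top inf S).2.
  by apply: contraNneq yr => E; move: xin; rewrite -E inE ltn_eqF.
case: ltngtP xy => // yx _.
have := leastP S ri; have := @le_least inf S r.
set m := least _ _ _ => mge mP.
case: ifP => [mb|_]; last first.
  by rewrite /valid uniq_letters_cons /= yx gtn_eqF //= /letters.
have bi : (top inf S).1 <= inf.
  case: (S) Ssub => [|[b x] S'] //= /(_ b).
  by rewrite mem_letters_cons eqxx inE => /(_ isT)/orP[/eqP->|/(allP ri)/ltnW].
have {mP} /andP[mr mS] : (m \in r) && (m \notin letters S).
  by case/orP: mP => // /eqP mi; move: mb; rewrite mi ltnNge bi.
have ym : y < m by apply: leq_trans yx (xmin m mr).
case/and3P: V => V1 V2 V3; apply/and3P; split.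
- case: (S) mb mS yx V1 xmin => //= [[b x] S'] /= mb mS yx -> /(_ m mr) xm.
  rewrite /nested /= mb yx ltn_neqAle xm !andbT.
  by apply: contraNneq mS => <-; rewrite mem_letters_cons eqxx orbT.
- by rewrite /= ym.
- by rewrite uniq_letters_cons mS yS V3 gtn_eqF.
Qed.

(** The letter inf, placed in front, makes the values inf in the list actual
    letters. The free letters U are left in an arbitrary order, which makes the
    induction go through: a suitable order can be chosen before each step. *)
Lemma keqv_letters_state inf r U : uniq r -> all (ltn^~ inf) r ->
  perm_eq (letters (state inf r) ++ U) (inf :: r) ->
  keqv (inf :: rev r) (letters (state inf r) ++ U).
Proof.
elim: r U => [|y r IH] U.
  by move=> _ _ /= P; rewrite (perm_small_eq _ P) //; exact: keqv_refl.
move=> /= /andP[yr ur] /andP[yi ri].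
have {}IH U' := IH U' ur ri.
have V := state_valid ur ri.
have [xmin _] := top_min ri; have lst := leastP (state inf r) ri.
have Ssub := letters_sub ri.
have yS : y \notin letters (state inf r).
  by apply: contra yr => /Ssub; rewrite inE ltn_eqF.
have uir : uniq (inf :: r) by rewrite /= ur andbT; apply/negP=> /(allP ri); rewrite /= ltnn.
rewrite rev_cons -rcons_cons -cats1 /update.
have [r0|r0] := eqVneq r [::].
  rewrite r0 /= ltnNge (ltnW yi) /= ltnn => P.
  have /perm_nilP-> : perm_eq U [::] by move: P; rewrite /letters /= !perm_cons.
  exact: keqv_refl.
have xr := top_min_mem ur ri r0.
have free_ge u : u \in inf :: r -> u \notin letters (state inf r) ->
    least inf (state inf r) r <= u.
  rewrite inE => /orP[/eqP-> _|]; [exact: least_le_top | exact: least_le].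
case/and3P: V; case: (state inf r) xr xmin Ssub yS free_ge IH lst => [|[b x] S] /=.
  by move=> /(allP ri); rewrite /= ltnn.
move=> xr xmin Ssub yS free_ge IH lst V1 /andP[xb V2] V3.
have below_free u : u \in inf :: r -> u \notin letters ((b, x) :: S) -> x < u.
  move=> uir'; rewrite mem_letters_cons !negb_or => /and3P[_ ux _].
  rewrite ltn_neqAle eq_sym ux; move: uir'; rewrite inE => /orP[/eqP->|/xmin//].
  exact/ltnW/(allP ri).
have uiyr : uniq [:: inf, y & r].
  by move: uir; rewrite /= !inE yr gtn_eqF.
have split_free T : perm_eq (letters T ++ U) [:: inf, y & r] ->
    uniq U /\ {in U, forall u, u \in [:: inf, y & r] /\ u \notin letters T}.
  move=> P; move: (uiyr); rewrite -(perm_uniq P) cat_uniq => /and3P[_ H uU].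
  split=> // u uin; split; last by apply: contra H => uT; apply/hasP; exists u.
  by rewrite -(perm_mem P) mem_cat uin orbT.
case: ltngtP => [xy|yx|E]; last by rewrite -E xr in yr.
- (* y is not a new minimum: it joins the free letters behind x. *)
  move=> P; have [uU UP] := split_free _ P.
  have yU : y \in U.
    have := perm_mem P y; rewrite mem_cat !inE eqxx orbT => /orP[]//.
    by rewrite (negPf yS).
  have P' : perm_eq (letters ((b, x) :: S) ++ rem y U) (inf :: r).
    apply/seq.permP=> f; have := seq.permP P f; have := seq.permP (perm_to_rem yU) f.
    rewrite !count_cat /=; move: (count _ _) (count f U) (count f r) (count f (rem _ _)).
    by move: (nat_of_bool _) (nat_of_bool _); clear; lia.
  have xU : all (ltn x) U.
    apply/allP=> u /UP[]; rewrite !inE => /or3P[/eqP->|/eqP->//|ur'] /= nS.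
      by apply: below_free; rewrite ?mem_head.
    by apply: below_free; rewrite ?inE ?ur' ?orbT.
  apply: keqv_trans (keqv_catr [:: y] (IH _ P')) _.
  rewrite letters_cons -!catA; apply: keqv_catl; apply: (@keqv_catl [:: b]) => /=.
  apply: keqv_sym; apply: keqv_above => //.
  by rewrite (perm_trans (perm_to_rem yU)) // perm_sym perm_catC.
- case: ifP => mb P; have [uU UP] := split_free _ P.
    (* The least free letter m is put last, and m y slides to the left. *)
    set m := least _ _ _ in lst free_ge mb P UP *.
    have P' : perm_eq (letters ((b, x) :: S) ++ (U ++ [:: m])) (inf :: r).
      apply/seq.permP=> f; have := seq.permP P f.
      rewrite (letters_cons m) !count_cat /=; move: (count _ _) (count f U) (count f r).
      by move: (nat_of_bool _) (nat_of_bool _) (nat_of_bool _); clear; lia.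
    have ym : y < m.
      apply: ltn_trans yx _; case/orP: lst => [/eqP->|/andP[mr mS]].
        exact: (allP ri).
      by apply: below_free; rewrite ?inE ?mr ?orbT.
    have mU : all (ltn m) U.
      apply/allP=> u /UP[]; rewrite mem_letters_cons !negb_or => uin /and3P[um uy uS].
      rewrite /= ltn_neqAle eq_sym um free_ge //.
      by move: uin; rewrite !inE (negPf uy).
    apply: keqv_trans (keqv_catr [:: y] (IH _ P')) _.
    rewrite (letters_cons m y) -!catA; do !apply: keqv_catl.
    exact: (keqv_slide ym mU).
  (* All free letters exceed b: b x slides to the right across them, and then
     x y slides to the left across everything else. *)
  set V := [seq u <- inf :: r | u \notin letters ((b, x) :: S)].
  have P' : perm_eq (letters ((b, x) :: S) ++ V) (inf :: r).
    apply: uniq_perm => //.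
      rewrite cat_uniq V3 filter_uniq // andbT; apply/hasPn=> u /=.
      by rewrite mem_filter => /andP[].
    move=> u; rewrite mem_cat mem_filter.
    by have [/Ssub|//] := boolP (u \in letters _).
  have bV : all (ltn b) V.
    apply/allP=> u; rewrite mem_filter => /andP[uS uin].
    have := free_ge _ uin uS; move: uS; rewrite mem_letters_cons !negb_or => /and3P[ub _ _].
    by rewrite /= ltn_neqAle eq_sym ub; apply: leq_trans; rewrite leqNgt mb.
  have xAll : all (ltn x) (letters S ++ V ++ [:: b]).
    rewrite !all_cat /= xb /= andbT; apply/andP; split; apply/allP=> u; last first.
      by move/(allP bV); apply: ltn_trans.
    move=> uS /=; have := Ssub u; rewrite mem_letters_cons uS !orbT => /(_ isT).
    move: V3; rewrite uniq_letters_cons => /and4P[_ _ xS _].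
    have ux : x != u by apply: contraNneq xS => ->.
    rewrite inE ltn_neqAle ux => /orP[/eqP->|/xmin//].
    exact/ltnW/(allP ri).
  apply: keqv_trans (keqv_catr [:: y] (IH _ P')) _.
  apply: (@keqv_trans _ (letters S ++ (V ++ [:: b; x]) ++ [:: y])).
    rewrite letters_cons -!catA; apply: keqv_catl; rewrite !catA.
    apply: keqv_catr; apply: keqv_sym; exact: (keqv_slide xb bV).
  have -> : letters S ++ (V ++ [:: b; x]) ++ [:: y] = (letters S ++ V ++ [:: b]) ++ [:: x; y].
    by rewrite -!catA.
  apply: keqv_trans (keqv_slide yx xAll) _.
  rewrite letters_cons; apply: (@keqv_catl [:: x]) => /=.
  have PW : perm_eq (letters S ++ V ++ [:: b]) U.
    apply/seq.permP=> f; have := seq.permP P f; have := seq.permP P' f.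
    rewrite !letters_cons !count_cat /=; move: (count f V) (count f U) (count f r).
    move: (count f (letters S)) (nat_of_bool (f b)) (nat_of_bool (f x)).
    by move: (nat_of_bool _) (nat_of_bool _); clear; lia.
  apply: keqv_above => //; first by rewrite (perm_uniq PW).
  by apply/allP=> u /(allP xAll); apply: ltn_trans.
Qed.

Lemma state_eq_keqv inf r1 r2 : uniq r1 -> all (ltn^~ inf) r1 -> perm_eq r1 r2 ->
  state inf r1 = state inf r2 -> keqv (rev r1) (rev r2).
Proof.
move=> u1 i1 P E.
have u2 : uniq r2 by rewrite -(perm_uniq P).
have i2 : all (ltn^~ inf) r2 by rewrite -(perm_all _ P).
set U := [seq u <- inf :: r1 | u \notin letters (state inf r1)].
have P1 : perm_eq (letters (state inf r1) ++ U) (inf :: r1).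
  have /and3P[_ _ uS] := state_valid u1 i1.
  have ui1 : uniq (inf :: r1).
    by rewrite /= u1 andbT; apply/negP=> /(allP i1); rewrite /= ltnn.
  apply: uniq_perm => //.
    rewrite cat_uniq uS filter_uniq // andbT; apply/hasPn=> u /=.
    by rewrite mem_filter => /andP[].
  move=> u; rewrite mem_cat mem_filter.
  by have [/(letters_sub i1)|//] := boolP (u \in letters _).
have P2 : perm_eq (letters (state inf r2) ++ U) (inf :: r2).
  by rewrite -E (permPl P1) perm_cons.
have K := keqv_trans (keqv_letters_state u1 i1 P1) (keqv_sym _).
have {K} := keqv_filter inf (K _ _); rewrite E => /(_ _ (keqv_letters_state u2 i2 P2)).
by rewrite /= ltnn !(all_filterP _) ?all_rev.
Qed.

(** * Every valid list is a state *)

Lemma state_above inf q r : all (ltn (top inf (state inf r)).2) q ->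
  state inf (q ++ r) = state inf r.
Proof.
elim: q => //= y q IH /andP[xy /IH->]; exact: update_above.
Qed.

(** Scanning the word of a valid list returns the list. Only b_1 may equal inf,
    and this letter is dropped. *)
Lemma state_letters inf S : valid S -> all (fun s => s.1 <= inf) S ->
  state inf (rev [seq u <- letters S | u < inf]) = S.
Proof.
elim: S => //= -[b x] S IH /and3P[V1 /= /andP[xb V2] V3] /andP[bi Vi].
move: V3; rewrite uniq_letters_cons => /and4P[_ bS xS V3].
have {IH} : state inf (rev [seq u <- letters S | u < inf]) = S.
  by apply: IH => //; rewrite /valid V2 V3 (path_sorted V1).
have xi : x < inf by apply: leq_trans bi.
rewrite letters_cons filter_cat [filter _ [:: b; x]]/= rev_cat xi.
case: S => [|[b' x'] S] in V1 V2 V3 Vi bS xS *.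
  rewrite /letters /= => _; case: (ltngtP b inf) bi => //= [bi _|bi _].
    have -> : update inf [::] [::] b = [:: (inf, b)].
      by rewrite /update /= ltnNge (ltnW bi) /= ltnn.
    by rewrite /update /= ltnNge (ltnW xb) /= /least /letters /= !inE eqxx orbT /= ltnn.
  by rewrite bi /update /= ltnNge (ltnW xi) /= ltnn.
move: V1 => /= /andP[/and3P[/= xx' x'b bb'] _].
move: Vi => /= /andP[b'i _].
set S' := (b', x') :: S in bS xS *; set r := rev (filter _ _) => E.
have -> : b < inf by apply: leq_trans b'i.
rewrite -[rev [:: b; x]]/[:: x; b] /= E (@update_above inf S') //=.
rewrite /update [in LHS]/= ltnNge (ltnW xx').
have -> : least inf S' (b :: r) = b.
  rewrite /least /= bS /=.
  have -> : [seq u <- r | u \notin letters S'] = [::].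
    apply/eqP; rewrite -(negbK (_ == _)) -has_filter; apply/hasPn=> u.
    by rewrite mem_rev mem_filter negbK => /andP[].
  by rewrite /= (minn_idPl _) // ltnW // (leq_trans bb').
by rewrite /= bb'.
Qed.

(** * From states to Motzkin paths *)

(** The step (1, s - 1) of a path is encoded by s. *)
Definition up : 'I_3 := @Ordinal 3 2 isT.
Definition flat : 'I_3 := @Ordinal 3 1 isT.
Definition down : 'I_3 := @Ordinal 3 0 isT.

(** The step carried by the letter v, given the first components B and the second
    components X of the pairs. *)
Definition label (X B : seq nat) (v : nat) : 'I_3 :=
  if v \in X then up else if v \in B then down else flat.

(** The first component b_1 of the oldest pair. *)
Definition last_b (S : seq (nat * nat)) := last 0 (unzip1 S).

(** The path of a list: the labels of the letters 2, ..., b_1 - 1. *)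
Definition code (S : seq (nat * nat)) : seq 'I_3 :=
  [seq label (unzip2 S) (unzip1 S) v | v <- iota 2 (last_b S - 2)].

(** The valid lists whose smallest letter x_k is 1; the default 0 of head excludes
    the empty list. *)
Definition proper S := valid S && (head 0 (unzip2 S) == 1).

Lemma perm_letters S : perm_eq (letters S) (unzip1 S ++ unzip2 S).
Proof.
elim: S => // -[b x] S IH; rewrite letters_cons perm_catC /= perm_cons.
by rewrite -[_ ++ x :: _]cat_rcons
  (permPr (perm_cat (permEl (perm_rcons _ _)) (perm_refl _))) /= perm_cons.
Qed.

Lemma valid_sorted_fst S : valid S -> sorted ltn (unzip1 S).
Proof.
by case/and3P=> V _ _; rewrite sorted_map; apply: sub_sorted V => s t /and3P[].
Qed.

Lemma valid_sorted_snd S : valid S -> sorted ltn (unzip2 S).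
Proof.
by case/and3P=> V _ _; rewrite sorted_map; apply: sub_sorted V => s t /and3P[].
Qed.

Lemma valid_disjoint S u : valid S -> u \in unzip1 S -> u \notin unzip2 S.
Proof.
case/and3P=> _ _; rewrite (perm_uniq (perm_letters S)) cat_uniq => /and3P[_ H _] u1.
by apply: contra H => u2; apply/hasP; exists u.
Qed.

Lemma sorted_le_last s u : sorted ltn s -> u \in s -> u <= last 0 s.
Proof.
elim: s => //= a s IH sr; rewrite inE => /orP[/eqP->|us].
  case: s {IH} sr => //= b s /andP[ab sr].
  have: last b s \in b :: s by exact: mem_last.
  have /allP H : all (ltn a) (b :: s) by apply: (order_path_min ltn_trans); rewrite /= ab.
  by move/H => /ltnW.
have : last a s = last 0 s by case: s us {IH sr}.
by move=> ->; apply: IH => //; apply: path_sorted sr.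
Qed.

Lemma valid_lt_last S u : valid S -> u \in unzip2 S -> u < last_b S.
Proof.
move=> V /mapP[s sS ->].
apply: leq_trans (sorted_le_last (valid_sorted_fst V) (map_f fst sS)).
by case/and3P: V => _ /allP/(_ _ sS).
Qed.

Lemma proper_gt0_snd S u : proper S -> u \in unzip2 S -> 0 < u.
Proof.
case/andP=> V /eqP h uS; move: h (valid_sorted_snd V) uS.
case: (unzip2 S) => //= a s -> sr; rewrite inE => /orP[/eqP->//|us].
have /allP/(_ _ us) : all (ltn 1) s by apply: (order_path_min ltn_trans sr).
exact: ltnW.
Qed.

Lemma proper_gt1_fst S u : proper S -> u \in unzip1 S -> 1 < u.
Proof.
move=> P /mapP[s sS ->]; have /andP[/and3P[_ /allP/(_ _ sS) lt _] _] := P.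
by apply: leq_trans lt; rewrite ltnS; apply: (proper_gt0_snd P); apply: map_f.
Qed.

Lemma code_subset S S' : proper S -> proper S' -> code S = code S' ->
  {subset unzip1 S <= unzip1 S'} /\ {subset unzip2 S <= unzip2 S'}.
Proof.
move=> P P' E; have /andP[V h] := P; have /andP[V' h'] := P'.
have nz T : proper T -> last_b T \in unzip1 T /\ 2 <= last_b T.
  move=> PT; suff lT : last_b T \in unzip1 T by split=> //; apply: (proper_gt1_fst PT).
  case/andP: PT => _; rewrite /last_b; case: T => //= s T _; exact: mem_last.
have [l1 l2] := nz S P; have [l1' l2'] := nz S' P'.
have L : last_b S = last_b S'.
  have := congr1 size E; rewrite !size_map !size_iota => El.
  by rewrite -(subnK l2) El subnK.
have lab v : 2 <= v < last_b S ->
    label (unzip2 S) (unzip1 S) v = label (unzip2 S') (unzip1 S') v.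
  move=> vb; have := E; rewrite /code -L => /eq_in_map; apply.
  by rewrite mem_iota subnKC.
have sub2 : {subset unzip2 S <= unzip2 S'}.
  move=> u uS; have := proper_gt0_snd P uS; rewrite leq_eqVlt => /orP[/eqP<-|u2].
    by case: (unzip2 S') h' => //= a s /eqP->; rewrite mem_head.
  have := lab u; rewrite u2 (valid_lt_last V uS) => /(_ isT).
  by rewrite /label uS; case: ifP => // _; case: ifP.
split=> // u uS; have [->|uL] := eqVneq u (last_b S); first by rewrite L.
have := lab u; rewrite (proper_gt1_fst P uS) ltn_neqAle uL (sorted_le_last (valid_sorted_fst V) uS).
move=> /(_ isT); rewrite /label (negPf (valid_disjoint V uS)) uS.
by case: ifP => // _; case: ifP.
Qed.

Lemma code_inj S S' : proper S -> proper S' -> code S = code S' -> S = S'.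
Proof.
move=> P P' E; have [s1 s2] := code_subset P P' E; have [t1 t2] := code_subset P' P (esym E).
have /andP[V _] := P; have /andP[V' _] := P'.
rewrite -(zip_unzip S) -(zip_unzip S'); congr zip.
  apply: (irr_sorted_eq ltn_trans ltnn (valid_sorted_fst V) (valid_sorted_fst V')) => u.
  by apply/idP/idP => [/s1|/t1].
apply: (irr_sorted_eq ltn_trans ltnn (valid_sorted_snd V) (valid_sorted_snd V')) => u.
by apply/idP/idP => [/s2|/t2].
Qed.

Lemma stepE : ((up : nat) = 2) * ((flat : nat) = 1) * ((down : nat) = 0).
Proof. by []. Qed.

Lemma height_cat p q : height (p ++ q) = (height p + height q)%R.
Proof. exact: big_cat. Qed.

Lemma height_cons s p : height (s :: p) = (s%:Z - 1 + height p)%R.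
Proof. exact: big_cons. Qed.

(** The number of entries of s that are smaller than t. *)
Definition below (t : nat) (s : seq nat) : nat := count (ltn^~ t) s.

Arguments below : simpl never.

Lemma below_cons t a s : below t (a :: s) = (a < t) + below t s.
Proof. by []. Qed.

Lemma belowS t s : uniq s -> below t.+1 s = below t s + (t \in s).
Proof.
move=> us; rewrite /below -(count_uniq_mem t us) -count_predUI.
rewrite (@eq_count _ (predI _ _) pred0) ?count_pred0 ?addn0 => [|u] /=.
  by apply: eq_count => u /=; rewrite ltnS leq_eqVlt orbC.
by case: ltngtP.
Qed.

(** The height of a labelling counts the ups minus the downs among the letters
    m, ..., m + k - 1; it is stated without subtraction. *)
Lemma height_label X B m k : uniq X -> uniq B -> {in B, forall u, u \notin X} ->
  (height [seq label X B v | v <- iota m k] + (below m X)%:Z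
     + (below (m + k)%N B)%:Z
   = (below (m + k)%N X)%:Z + (below m B)%:Z)%R.
Proof.
move=> uX uB dis; elim: k => [|k IH].
  by rewrite addn0 /height big_nil add0r.
have -> : iota m k.+1 = iota m k ++ [:: (m + k)%N] by rewrite -addn1 iotaD.
rewrite map_cat height_cat [map _ [:: _]]/= height_cons [height [::]]big_nil addr0.
rewrite addnS !belowS // {2}/label.
have dk := dis (m + k).
case: ifP => [mX|_]; last first.
  by case: ifP => [_|_]; rewrite stepE; lia.
have -> : (m + k \in B) = false by apply/negP => /dk; rewrite mX.
rewrite stepE; lia.
Qed.

(** Up to b_1, the second components are ahead of the first ones. For x_k = 1 the
    difference of the two counts is the height of the path plus one, because the
    letter 1 carries no step. *)
Lemma nested_count S t : valid S -> head 0 (unzip2 S) < t -> t <= last_b S ->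
  below t (unzip1 S) < below t (unzip2 S).
Proof.
elim: S => [|[b x] S IH] V.
  by rewrite /last_b /= => + /(leq_trans _) H; move/H.
have VS : valid S.
  case/and3P: V => /path_sorted V1 /= /andP[_ V2].
  by rewrite uniq_letters_cons => /and4P[_ _ _ V3]; rewrite /valid V1 V2.
case/and3P: V => /= V1 /andP[/= xb _] _; rewrite /last_b /= => xt tl.
have bx : (b < t) <= (x < t) by case: (ltnP b t) => // bt; rewrite (ltn_trans xb bt).
rewrite !below_cons.
case: S V1 VS IH tl => [|[b' x'] S] V1 VS IH tl.
  by rewrite /= in tl; rewrite xt [b < t]ltnNge tl.
case/andP: V1 => /and3P[/= xx' x'b bb'] _.
have [x't|tx'] := ltnP x' t.
  have := IH VS x't tl; rewrite /= !below_cons; move: bx; rewrite x't; clear; lia.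
have -> : (b < t) = false by apply/negbTE; rewrite -leqNgt (leq_trans tx') // ltnW.
rewrite xt.
suff -> : below t (unzip1 ((b', x') :: S)) = 0 by [].
apply/eqP; rewrite -leqn0 leqNgt -has_count; apply/hasPn=> u us /=.
rewrite -leqNgt (leq_trans tx') //.
have b'u : b' <= u.
  have := valid_sorted_fst VS; move: us; rewrite /= inE => /orP[/eqP->//|us].
  by move/(order_path_min ltn_trans)/allP/(_ _ us)/ltnW.
by apply: leq_trans b'u; rewrite ltnW // (ltn_trans x'b).
Qed.

Lemma code_motzkin S : proper S -> is_motzkin_path (code S).
Proof.
move=> P; have /andP[V h] := P; have /and3P[_ _ uS] := V.
move: uS; rewrite (perm_uniq (perm_letters S)) cat_uniq => /and3P[u1 _ u2].
have l1 : last_b S \in unzip1 S.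
  by move: h; rewrite /last_b; case: (S) => //= s T _; exact: mem_last.
have l2 := proper_gt1_fst P l1.
have c2 : below 2 (unzip2 S) = 1.
  rewrite /below (@eq_in_count _ _ (pred1 1)) ?count_uniq_mem //.
    by move: h; case: (unzip2 S) => //= a s /eqP->; rewrite mem_head.
  by move=> u /(proper_gt0_snd P) u0 /=; rewrite ltnS eqn_leq u0 andbT.
have c1 : below 2 (unzip1 S) = 0.
  apply/eqP; rewrite -leqn0 leqNgt -has_count; apply/hasPn=> u /(proper_gt1_fst P) u1'.
  by rewrite /= -leqNgt.
have H k : k <= size (code S) -> (height (take k (code S)) + 1 +
    (below (2 + k)%N (unzip1 S))%:Z = (below (2 + k)%N (unzip2 S))%:Z)%R.
  rewrite size_map size_iota => kl.
  rewrite -map_take take_iota (minn_idPl kl).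
  have := @height_label _ _ 2 k u2 u1 (fun u => @valid_disjoint S u V).
  by rewrite c1 c2 addr0.
apply/andP; split.
  apply/allP=> k; rewrite mem_iota /= add0n ltnS => kl.
  have := H k kl; have := @nested_count S (2 + k) V.
  rewrite (eqP h) => /(_ isT); move: kl; rewrite size_map size_iota => kl.
  have -> : 2 + k <= last_b S by clear -kl l2; lia.
  move=> /(_ isT); lia.
have := H _ (leqnn _); rewrite take_size size_map size_iota subnKC //.
have -> : below (last_b S) (unzip2 S) = size S.
  rewrite /below -(size_map snd); apply/eqP; rewrite -all_count; apply/allP=> u.
  exact: valid_lt_last.
have -> : size S = (below (last_b S) (unzip1 S)).+1.
  have := count_predC (ltn^~ (last_b S)) (unzip1 S); rewrite -/(below _ _).
  rewrite (@eq_in_count _ (predC _) (pred1 (last_b S))).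
    by rewrite count_uniq_mem // l1 size_map addn1.
  move=> u us /=; have := sorted_le_last (valid_sorted_fst V) us.
  by rewrite -leqNgt eqn_leq => ->.
by rewrite -natz; lia.
Qed.

(** * From Motzkin paths to states *)

(** The inverse of code, for a path p whose first step is carried by the letter v;
    the pair of the smallest letter is left out. The path is read from its end; Q
    is the queue of the letters b that are still waiting for a partner, the first
    to be served being the largest. The queue starts with the letter after the
    path, a down step adds its letter to the queue, and an up step pairs its letter
    with the head of the queue. *)
Fixpoint decode (v : nat) (p : seq 'I_3) : seq nat * seq (nat * nat) :=
  if p is s :: p' then
    let: (Q, T) := decode v.+1 p' in
    if s == up then (behead Q, (head 0 Q, v) :: T)
    else if s == down then (rcons Q v, T) else (Q, T)
  else ([:: v], [::]).

Lemma step_cases (s : 'I_3) : [\/ s = up, s = flat | s = down].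
Proof.
by case: s => [[|[|[|m]]] lt] //; [apply: Or33 | apply: Or32 | apply: Or31]; apply: val_inj.
Qed.

(** The path p starts at height h and ends at height 0; the queue then has h + 1
    letters. In the conditions on nested, the head of the queue is completed by an
    arbitrary letter x smaller than v to the pair that it will form. *)
Lemma decode_spec h p v :
    (forall k, 0 <= h%:Z + height (take k p))%R -> (h%:Z + height p = 0)%R ->
  let: (Q, T) := decode v p in let L := Q ++ unzip1 T ++ unzip2 T in
  [/\ size Q = h.+1, sorted gtn Q, all (leq v) L & uniq L] /\
  [/\ forall x, x < v -> sorted nested ((head 0 Q, x) :: T),
      all (fun s => s.2 < s.1) T,
      last (head 0 Q) (unzip1 T) = v + size p &
      p = [seq label (unzip2 T) (Q ++ unzip1 T) u | u <- iota v (size p)]].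
Proof.
elim: p h v => [|s p IH] h v nonneg total.
  have -> : h = 0 by move: total; rewrite /height big_nil; lia.
  by split; split; rewrite ?addn0 //= leqnn.
rewrite height_cons in total.
have shift h' : (h'%:Z = h%:Z + (s%:Z - 1))%R ->
    let: (Q, T) := decode v.+1 p in let L := Q ++ unzip1 T ++ unzip2 T in
    [/\ size Q = h'.+1, sorted gtn Q, all (leq v.+1) L & uniq L] /\
    [/\ forall x, x < v.+1 -> sorted nested ((head 0 Q, x) :: T),
        all (fun s => s.2 < s.1) T,
        last (head 0 Q) (unzip1 T) = v.+1 + size p &
        p = [seq label (unzip2 T) (Q ++ unzip1 T) u | u <- iota v.+1 (size p)]].
  move=> E; apply: IH => [k|]; last by rewrite E -addrA.
  by have := nonneg k.+1; rewrite /= height_cons E addrA.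
have relabel X B X' B' : {in iota v.+1 (size p), X =i X'} -> {in iota v.+1 (size p), B =i B'} ->
    [seq label X B u | u <- iota v.+1 (size p)] = [seq label X' B' u | u <- iota v.+1 (size p)].
  by move=> EX EB; apply/eq_in_map => u uin; rewrite /label (EX u uin) (EB u uin).
rewrite /=; case: (decode v.+1 p) shift => Q S shift.
have [E|E|E] := step_cases s.
- have [|[sQ srt geL uL] [nest xb lst lab]] := shift h.+1; first by rewrite E stepE; lia.
  rewrite E eqxx; case: Q {shift} => [|q Q] // in sQ srt geL uL nest lst lab *.
  have vL : v \notin (q :: Q) ++ unzip1 S ++ unzip2 S.
    by apply/negP=> /(allP geL); rewrite ltnn.
  have Pm : perm_eq (Q ++ unzip1 ((q, v) :: S) ++ unzip2 ((q, v) :: S))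
      (v :: (q :: Q) ++ unzip1 S ++ unzip2 S).
    by apply/seq.permP=> f; rewrite /= !count_cat /= !count_cat /=; lia.
  rewrite [behead _]/= [head _ _]/=.
  have qv : v < q by move: geL => /= /andP[].
  split; split.
  + by case: sQ.
  + exact: path_sorted srt.
  + rewrite (perm_all _ Pm) [all _ (_ :: _)]/= leqnn.
    by apply: sub_all geL => u; apply: ltnW.
  + by rewrite (perm_uniq Pm) [uniq (_ :: _)]/= vL.
  + case: Q sQ srt geL {uL nest lab vL Pm lst} (nest v (ltnSn v)) => // q' Q _ /= /andP[q'q _].
    case/and3P=> _ vq' _ nest x xv.
    by rewrite /= {1}/nested /= xv vq' q'q.
  + by rewrite /= qv.
  + by rewrite [size _]/= addnS -addSn -lst.
  + rewrite /= {1}/label mem_head; congr cons; rewrite {1}lab.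
    apply: relabel => u; rewrite mem_iota => /andP[vu _].
      by rewrite [unzip2 _]/= inE (gtn_eqF vu).
    by rewrite !(mem_cat, inE); case: (u == q); rewrite ?orbT.
- have [|[sQ srt geL uL] [nest xb lst lab]] := shift h; first by rewrite E stepE; lia.
  have vL : v \notin Q ++ unzip1 S ++ unzip2 S.
    by apply/negP=> /(allP geL); rewrite ltnn.
  rewrite E /=; split; split=> //.
  + by apply: sub_all geL => u; apply: ltnW.
  + by move=> x xv; apply: nest; apply: ltnW.
  + by rewrite addnS -addSn -lst.
  + move: vL; rewrite catA mem_cat negb_or => /andP[v1 v2].
    by rewrite {1}/label (negPf v1) (negPf v2) -lab.
have [h' hh'] : exists h', h = h'.+1.
  have := nonneg 1; rewrite /= take0 height_cons /height big_nil E stepE.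
  by case: (h) => [|h'] ?; [lia | exists h'].
have [|[sQ srt geL uL] [nest xb lst lab]] := shift h'; first by rewrite hh' E stepE; lia.
rewrite E /=; have vL : v \notin Q ++ unzip1 S ++ unzip2 S.
  by apply/negP=> /(allP geL); rewrite ltnn.
have Pm : perm_eq (rcons Q v ++ unzip1 S ++ unzip2 S) (v :: Q ++ unzip1 S ++ unzip2 S).
  by rewrite -cats1 -catA perm_catCA.
have hQ : head 0 (rcons Q v) = head 0 Q by case: (Q) sQ.
split; split.
+ by rewrite size_rcons sQ hh'.
+ case: (Q) srt geL => //= q Q' srt.
  rewrite rcons_path srt /= => /andP[vq].
  have: last q Q' \in q :: Q' by exact: mem_last.
  rewrite inE all_cat => /orP[/eqP->//|lQ] /andP[/allP/(_ _ lQ)]; exact.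
+ rewrite (perm_all _ Pm) /= leqnn.
  by apply: sub_all geL => u; apply: ltnW.
+ by rewrite (perm_uniq Pm) /= vL.
+ by move=> x xv; rewrite hQ; apply: nest; apply: ltnW.
+ exact: xb.
+ by rewrite hQ addnS -addSn -lst.
+ have v2 : v \notin unzip2 S by apply: contra vL; rewrite !mem_cat => ->; rewrite !orbT.
  rewrite {1}/label (negPf v2) mem_cat mem_rcons mem_head; congr cons; rewrite {1}lab.
  apply: relabel => u; rewrite mem_iota => /andP[vu _] //.
  by rewrite !mem_cat mem_rcons inE (gtn_eqF vu).
Qed.

Lemma code_surj p : is_motzkin_path p ->
  exists S, [/\ proper S, code S = p & {in letters S, forall u, u <= size p + 2}].
Proof.
case/andP=> /allP pos /eqP tot.
have nonneg k : (0 <= 0%:Z + height (take k p))%R.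
  rewrite add0r; have [kp|pk] := leqP k (size p); first by apply: pos; rewrite mem_iota.
  by rewrite take_oversize ?tot // ltnW.
have := decode_spec 2 nonneg; rewrite add0r => /(_ tot).
case: (decode 2 p) => Q S [[sQ _ geL uL] [nest xb lst lab]].
case: Q sQ geL uL nest lst lab => [|q []] // _ geL uL nest lst lab.
have V : valid ((q, 1) :: S).
  have q1 : 1 < q by case/andP: geL.
  apply/and3P; split; [exact: nest | by rewrite /= q1 | ].
  rewrite (perm_uniq (perm_letters _)).
  have Pm : perm_eq (unzip1 ((q, 1) :: S) ++ unzip2 ((q, 1) :: S))
      (1 :: [:: q] ++ unzip1 S ++ unzip2 S).
    by apply/seq.permP=> f; rewrite /= !count_cat /=; lia.
  rewrite (perm_uniq Pm) cons_uniq uL andbT.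
  by apply/negP=> /(allP geL).
have lb : last_b ((q, 1) :: S) = size p + 2 by rewrite /last_b /= lst addnC.
exists ((q, 1) :: S); split; first by rewrite /proper V.
  rewrite /code lb addnK [RHS]lab; apply/eq_in_map=> u; rewrite mem_iota => /andP[u2 _].
  by rewrite /label /= inE (gtn_eqF u2).
move=> u; rewrite (perm_mem (perm_letters _)) mem_cat -lb => /orP[].
  exact/sorted_le_last/valid_sorted_fst.
by move/(valid_lt_last V)/ltnW.
Qed.

(** * Permutations and their words *)

Lemma nth_word n (p : 'S_n) (i : 'I_n) : nth 0 (word p) i = (p i).+1.
Proof.
rewrite (nth_map i) ?size_enum_ord //; congr (nat_of_ord (p _)).+1.
exact: nth_ord_enum.
Qed.

Lemma word_inj n : injective (@word n).
Proof.
move=> p q E; apply/permP=> i; apply: val_inj.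
by have := congr1 (nth 0 ^~ i) E; rewrite !nth_word => -[].
Qed.

Lemma perm_word n (p : 'S_n) : perm_eq (word p) (iota 1 n).
Proof.
have sub : {subset word p <= iota 1 n}.
  by move=> u /mapP[i _ ->]; rewrite mem_iota add1n ltnS; exact: ltn_ord.
have uw : uniq (word p).
  by rewrite map_inj_uniq ?enum_uniq // => i j [/val_inj/perm_inj].
apply: uniq_perm; rewrite ?iota_uniq //.
by have [] := uniq_min_size uw sub; rewrite ?size_word ?size_iota.
Qed.

Lemma word_surj n (w : seq nat) : perm_eq w (iota 1 n) -> exists p : 'S_n, word p = w.
Proof.
move=> P; have sz : size w = n by rewrite (perm_size P) size_iota.
have wlt (i : 'I_n) : (nth 0 w i).-1 < n.
  have : nth 0 w i \in iota 1 n by rewrite -(perm_mem P) mem_nth // sz.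
  by rewrite mem_iota; lia.
have wpos (i : 'I_n) : (nth 0 w i).-1.+1 = nth 0 w i.
  have : nth 0 w i \in iota 1 n by rewrite -(perm_mem P) mem_nth // sz.
  by rewrite mem_iota; lia.
pose f i := Ordinal (wlt i).
have finj : injective f.
  move=> i j /(congr1 val) /= /(congr1 succn); rewrite !wpos => /eqP.
  by rewrite nth_uniq ?sz // ?(perm_uniq P) ?iota_uniq // => /eqP/val_inj.
exists (perm finj); apply: (@eq_from_nth _ 0); first by rewrite size_word sz.
by move=> i; rewrite size_word => lti; rewrite (nth_word _ (Ordinal lti)) permE wpos.
Qed.

(** Order permutations, with s replaced by its word. *)
Lemma is_order_permP c (u : seq nat) (s : 'S_c) :
  reflect (size u = c /\ forall i j, i < c -> j < c ->
             (nth 0 (word s) i < nth 0 (word s) j) = (nth 0 u i < nth 0 u j))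
          (is_order_perm u s).
Proof.
apply: (iffP andP) => [[/eqP sz /forallP H]|[sz H]]; split=> //; last 2 first.
- by rewrite sz.
- apply/forallP=> i; apply/forallP=> j; rewrite -(H i j) //.
  by rewrite !nth_word ltnS.
move=> i j ilt jlt; have /forallP/(_ (Ordinal jlt))/eqP := H (Ordinal ilt).
by rewrite (nth_word s (Ordinal ilt)) (nth_word s (Ordinal jlt)) ltnS.
Qed.

Lemma order_perm3P (x y z a b c : nat) (s : 'S_3) : word s = [:: a; b; c] ->
  is_order_perm [:: x; y; z] s <->
  [/\ (a < b) = (x < y), (a < c) = (x < z), (b < c) = (y < z) &
   [/\ (b < a) = (y < x), (c < a) = (z < x) & (c < b) = (z < y)]].
Proof.
move=> ws; split=> [/is_order_permP[_ H]|H].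
  have := H 0 1; have := H 0 2; have := H 1 2; have := H 1 0; have := H 2 0; have := H 2 1.
  by rewrite ws /=; do 6 (move=> /(_ isT isT) ?).
apply/is_order_permP; split=> //; rewrite ws.
case: H => H1 H2 H3 [H4 H5 H6].
by case=> [|[|[|i]]] // [|[|[|j]]] // _ _ /=; rewrite ?ltnn.
Qed.

Local Notation K := K_123_132__213_321.

(** The words of the two parts of K with more than one element. *)
Definition part_acb := [:: [:: 1; 2; 3]; [:: 1; 3; 2]].
Definition part_bac := [:: [:: 2; 1; 3]; [:: 3; 2; 1]].

Lemma in_K (s t : 'S_3) :
  (exists2 P, P \in K & (s \in P) && (t \in P)) <->
  [\/ s = t, (word s \in part_acb) && (word t \in part_acb) |
      (word s \in part_bac) && (word t \in part_bac)].
Proof.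
split=> [[P]|].
  rewrite /K_123_132__213_321 /with_singletons !inE -orbA => /or3P[].
  - by move/eqP->; rewrite !in_set; rewrite !inE => H; apply: Or32.
  - by move/eqP->; rewrite !in_set; rewrite !inE => H; apply: Or33.
  - by case/imsetP=> r _ ->; rewrite !in_set1 => /andP[/eqP-> /eqP->]; apply: Or31.
case=> [->|H|H].
- have /and3P[/eqP covK _ _] := K_123_132__213_321_partition.
  have : t \in cover K by rewrite covK inE.
  by case/bigcupP=> P PK tP; exists P; rewrite ?tP.
- exists [set r : 'S_3 | word r \in part_acb]; last by rewrite !in_set.
  by rewrite /K_123_132__213_321 /with_singletons !inE eqxx.
- exists [set r : 'S_3 | word r \in part_bac]; last by rewrite !in_set.
  by rewrite /K_123_132__213_321 /with_singletons !inE eqxx orbT.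
Qed.

(** A replacement leaves the set of three letters unchanged, so the two order
    permutations determine how these letters are rearranged. *)
Lemma replacement_keqv n (phi psi : 'S_n) : replacement K phi psi ->
  keqv (word phi) (word psi).
Proof.
case/replacementP=> a [u [v [b [E1 E2 [P [s [t [PK sP tP us vt]]]]]]]].
have Puv : perm_eq u v.
  have := perm_word psi; rewrite perm_sym; move/(perm_trans (perm_word phi)).
  by rewrite E1 E2 perm_cat2l perm_cat2r.
have uu : uniq u.
  have := perm_uniq (perm_word phi); rewrite iota_uniq E1 !cat_uniq.
  by case/and3P=> _ _ /andP[].
rewrite E1 E2; apply: keqv_cat; clear E1 E2.
have K_st : (exists2 P, P \in K & (s \in P) && (t \in P)) by exists P; rewrite ?sP.
have [su _] := is_order_permP _ _ us; have [sv _] := is_order_permP _ _ vt.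
case: u v su sv us vt uu Puv => [|x [|y [|z []]]] // [|x' [|y' [|z' []]]] //.
move=> _ _ us vt uu Puv.
have mem := perm_mem Puv.
have := mem z'; have := mem y'; have := mem x'; rewrite !inE !eqxx !orbT {mem Puv}.
move=> memx memy memz.
case/in_K: K_st => [E||].
- have [e [f [g ws]]] : exists e f g, word s = [:: e; f; g].
    by case: (word s) (size_word s) => [|e [|f [|g []]]] // _; exists e, f, g.
  move: vt us; rewrite -E => /(order_perm3P _ _ _ ws)[h1 h2 h3 [h4 h5 h6]].
  case/(order_perm3P _ _ _ ws)=> k1 k2 k3 [k4 k5 k6].
  suff [-> -> ->] : [/\ x = x', y = y' & z = z'] by exact: keqv_refl.
  move: uu; rewrite /= !inE.
  have {}h1 : (x < y) = (x' < y') by congruence.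
  have {}h2 : (x < z) = (x' < z') by congruence.
  have {}h3 : (y < z) = (y' < z') by congruence.
  have {}h4 : (y < x) = (y' < x') by congruence.
  have {}h5 : (z < x) = (z' < x') by congruence.
  have {}h6 : (z < y) = (z' < y') by congruence.
  clear -h1 h2 h3 h4 h5 h6 memx memy memz => uu; split; lia.
- rewrite !inE => /andP[/orP[]/eqP ws /orP[]/eqP wt];
    move: us vt => /(order_perm3P _ _ _ ws)[/= h1 h2 h3 [h4 h5 h6]];
    move=> /(order_perm3P _ _ _ wt)[/= k1 k2 k3 [k4 k5 k6]].
  + suff [-> -> ->] : [/\ x = x', y = y' & z = z'] by exact: keqv_refl.
    clear -h1 h2 h3 k1 k2 k3 memx memy memz; split; lia.
  + suff [-> -> ->] : [/\ x = x', y = z' & z = y'].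
      by apply: (@keqv_acb [::] [::]).
    clear -h1 h2 h3 k1 k2 k6 memx memy memz; split; lia.
  + suff [-> -> ->] : [/\ x = x', y = z' & z = y'].
      by apply: keqv_sym; apply: (@keqv_acb [::] [::]).
    clear -h1 h2 h6 k1 k2 k3 memx memy memz; split; lia.
  + suff [-> -> ->] : [/\ x = x', y = y' & z = z'] by exact: keqv_refl.
    clear -h1 h2 h6 k1 k2 k6 memx memy memz; split; lia.
- rewrite !inE => /andP[/orP[]/eqP ws /orP[]/eqP wt];
    move: us vt => /(order_perm3P _ _ _ ws)[/= h1 h2 h3 [h4 h5 h6]];
    move=> /(order_perm3P _ _ _ wt)[/= k1 k2 k3 [k4 k5 k6]].
  + suff [-> -> ->] : [/\ x = x', y = y' & z = z'] by exact: keqv_refl.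
    clear -h4 h2 h3 k4 k2 k3 memx memy memz; split; lia.
  + suff [-> -> ->] : [/\ x = y', y = z' & z = x'].
      by apply: (@keqv_bac [::] [::]).
    clear -h4 h2 h3 k4 k5 k6 memx memy memz; split; lia.
  + suff [-> -> ->] : [/\ x = z', y = x' & z = y'].
      by apply: keqv_sym; apply: (@keqv_bac [::] [::]).
    clear -h4 h5 h6 k4 k2 k3 memx memy memz; split; lia.
  + suff [-> -> ->] : [/\ x = x', y = y' & z = z'] by exact: keqv_refl.
    clear -h4 h5 h6 k4 k5 k6 memx memy memz; split; lia.
Qed.

Lemma keqv_Kequiv u v n (phi psi : 'S_n) : keqv u v ->
  word phi = u -> word psi = v -> Kequiv K phi psi.
Proof.
have word3 w : w \in [:: [:: 1; 2; 3]; [:: 1; 3; 2]; [:: 2; 1; 3]; [:: 3; 2; 1]] ->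
    exists s : 'S_3, word s = w.
  by move=> win; apply: word_surj; move: win; rewrite !inE => /or4P[]/eqP->.
have step p q x y z x' y' z' (s t : 'S_3) (f g : 'S_n) :
    (word s \in part_acb) && (word t \in part_acb) ||
      (word s \in part_bac) && (word t \in part_bac) ->
    is_order_perm [:: x; y; z] s -> is_order_perm [:: x'; y'; z'] t ->
    word f = p ++ [:: x, y, z & q] -> word g = p ++ [:: x', y', z' & q] ->
    Kequiv K f g.
  move=> st us vt E1 E2; apply: connect1; apply/replacementP.
  exists p, [:: x; y; z], [:: x'; y'; z'], q; split=> //.
  have /in_K[P PK /andP[sP tP]] : [\/ s = t,
      (word s \in part_acb) && (word t \in part_acb) |
      (word s \in part_bac) && (word t \in part_bac)].
    by case/orP: st; [apply: Or32 | apply: Or33].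
  by exists P, s, t.
move=> uv; elim: uv phi psi => {u v}.
- by move=> w phi psi E1 E2; rewrite (word_inj (etrans E1 (esym E2))); exact: connect0.
- move=> u v _ IH phi psi E1 E2; rewrite /Kequiv.
  by rewrite (sym_connect_sym (@replacement_sym _ K n)); exact: IH.
- move=> u v w uv IH1 _ IH2 phi psi E1 E2.
  have [chi E] : exists chi : 'S_n, word chi = v.
    apply: word_surj; rewrite -(permPl (keqv_perm uv)) -E1; exact: perm_word.
  exact: connect_trans (IH1 _ _ E1 E) (IH2 _ _ E E2).
- move=> p q a b c ab bc phi psi E1 E2; have ac := ltn_trans ab bc.
  have [s ws] := word3 [:: 1; 2; 3] isT; have [t wt] := word3 [:: 1; 3; 2] isT.
  apply: (step _ _ _ _ _ _ _ _ s t _ _ _ _ _ E1 E2); first by rewrite ws wt.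
    by apply/(order_perm3P _ _ _ ws); clear -ab bc ac; do 2?split; lia.
  by apply/(order_perm3P _ _ _ wt); clear -ab bc ac; do 2?split; lia.
- move=> p q a b c ab bc phi psi E1 E2; have ac := ltn_trans ab bc.
  have [s ws] := word3 [:: 2; 1; 3] isT; have [t wt] := word3 [:: 3; 2; 1] isT.
  apply: (step _ _ _ _ _ _ _ _ s t _ _ _ _ _ E1 E2); first by rewrite ws wt.
    by apply/(order_perm3P _ _ _ ws); clear -ab bc ac; do 2?split; lia.
  by apply/(order_perm3P _ _ _ wt); clear -ab bc ac; do 2?split; lia.
Qed.

Lemma KequivP n (phi psi : 'S_n) :
  Kequiv K phi psi <-> keqv (word phi) (word psi).
Proof.
split=> [|/keqv_Kequiv]; last exact.
case/connectP=> p + ->; elim: p phi => [|chi p IH] phi /=.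
  by move=> _; exact: keqv_refl.
by case/andP=> /replacement_keqv E /IH; apply: keqv_trans E.
Qed.

(** * Counting the classes *)

(** If f is a complete invariant of R, the classes are counted by its values. *)
Lemma card_equivalence_partition (T : finType) (U : eqType) (R : rel T) (f : T -> U) :
  (forall x y, R x y = (f x == f y)) ->
  #|equivalence_partition R [set: T]| = size (undup [seq f x | x <- enum T]).
Proof.
move=> Rf; pose g t := [set y | t == f y].
have mem_g t : t \in undup [seq f x | x <- enum T] -> exists x, t = f x.
  by rewrite mem_undup => /mapP[x _ ->]; exists x.
rewrite cardE -(size_map g); apply: perm_size; apply: uniq_perm.
- exact: enum_uniq.
- rewrite map_inj_in_uniq ?undup_uniq // => t u /mem_g[x ->] /mem_g[y ->] /setP/(_ x).
  by rewrite !inE eqxx => /esym/eqP.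
move=> B; rewrite mem_enum; apply/imsetP/mapP => [[x _ ->]|[t /mem_g[x ->] ->]].
  exists (f x); first by rewrite mem_undup map_f ?mem_enum.
  by apply/setP=> y; rewrite !inE Rf.
by exists x => //; apply/setP=> y; rewrite !inE Rf.
Qed.

(** All Motzkin paths with fewer than n steps. *)
Definition motzkin_paths n : seq (seq 'I_3) :=
  [seq val p | i <- iota 0 n, p <- enum [set p : i.-tuple 'I_3 | is_motzkin_path p]].

Lemma mem_motzkin_paths n p :
  (p \in motzkin_paths n) = is_motzkin_path p && (size p < n).
Proof.
apply/allpairsPdep/andP => [[i [t [+ + ->]]]|[mp szp]].
  by rewrite mem_iota mem_enum inE size_tuple.
by exists (size p), (in_tuple p); rewrite mem_iota mem_enum inE.
Qed.

Lemma uniq_motzkin_paths n : uniq (motzkin_paths n).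
Proof.
apply: allpairs_uniq_dep => [|i _|]; rewrite ?iota_uniq ?enum_uniq //.
move=> [i p] [j q] _ _ /= E.
have ij : i = j by rewrite -(size_tuple p) -(size_tuple q) E.
by subst j; congr existT; apply: val_inj.
Qed.

Lemma size_motzkin_paths n : size (motzkin_paths n) = \sum_(0 <= i < n) motzkin i.
Proof.
rewrite size_allpairs_dep sumnE big_map /index_iota subn0.
by apply: eq_bigr => i _; rewrite /motzkin cardE.
Qed.

(** The list attached to a permutation; n + 1 plays the role of infinity. *)
Definition state_of n (phi : 'S_n) := state n.+1 (rev (word phi)).

Lemma uniq_word n (phi : 'S_n) : uniq (word phi).
Proof. by rewrite (perm_uniq (perm_word phi)) iota_uniq. Qed.

Lemma word_le n (phi : 'S_n) : all (ltn^~ n.+1) (word phi).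
Proof. by rewrite (perm_all _ (perm_word phi)); apply/allP=> u; rewrite mem_iota => /andP[]. Qed.

Lemma Kequiv_state n (phi psi : 'S_n) :
  Kequiv K phi psi = (state_of phi == state_of psi).
Proof.
apply/idP/eqP => [/KequivP|E]; first by apply: state_keqv; [exact: uniq_word | exact: word_le].
apply/KequivP; rewrite -[word phi]revK -[word psi]revK; apply: (@state_eq_keqv n.+1) => //.
- by rewrite rev_uniq uniq_word.
- by rewrite all_rev word_le.
- by rewrite perm_rev perm_sym perm_rev perm_sym (permPl (perm_word phi)) perm_sym perm_word.
Qed.

Lemma state_of_proper n (phi : 'S_n) : 0 < n ->
  proper (state_of phi) /\ size (code (state_of phi)) < n.
Proof.
move=> n0; have ur : uniq (rev (word phi)) by rewrite rev_uniq uniq_word.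
have ir : all (ltn^~ n.+1) (rev (word phi)) by rewrite all_rev word_le.
have memw u : (u \in rev (word phi)) = (0 < u <= n).
  by rewrite mem_rev (perm_mem (perm_word phi)) mem_iota add1n ltnS.
have [/(_ 1) xmin xin] := top_min ir; have V := state_valid ur ir.
have Ssub := letters_sub ir.
have x1 : (top n.+1 (state_of phi)).2 = 1.
  apply/eqP; rewrite eqn_leq xmin ?memw //=.
  by move: xin; rewrite inE memw => /orP[/eqP->|/andP[]].
have P : proper (state_of phi).
  rewrite /proper V /=; move: x1; case: (state_of phi) => [[E]|s T /= ->] //=.
  by rewrite -E ltnn in n0.
split=> //; rewrite size_map size_iota.
have : last_b (state_of phi) <= n.+1.
  have /Ssub : last_b (state_of phi) \in letters (state_of phi).
    rewrite (perm_mem (perm_letters _)) mem_cat; apply/orP; left.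
    by case/andP: P => _; rewrite /last_b; case: (state_of phi) => //= s T _; exact: mem_last.
  by rewrite inE memw => /orP[/eqP->//|/andP[_ /leqW]].
by clear -n0; lia.
Qed.

Lemma state_of_surj n S : proper S -> {in letters S, forall u, u <= n.+1} ->
  exists phi : 'S_n, state_of phi = S.
Proof.
move=> P Sn; have /andP[V /eqP h] := P; have /and3P[_ _ uS] := V.
set w := [seq u <- letters S | u < n.+1].
set U := [seq u <- iota 1 n | u \notin letters S].
have pos u : u \in letters S -> 0 < u.
  rewrite (perm_mem (perm_letters S)) mem_cat => /orP[/(proper_gt1_fst P)/ltnW//|].
  exact: proper_gt0_snd.
have Pm : perm_eq (w ++ U) (iota 1 n).
  apply: uniq_perm; rewrite ?iota_uniq // ?cat_uniq ?filter_uniq ?iota_uniq //= ?andbT.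
    apply/hasPn=> u; rewrite !mem_filter => /andP[uNS _].
    by rewrite negb_and uNS orbT.
  move=> u; rewrite mem_cat !mem_filter mem_iota add1n andbC.
  case: (boolP (u \in letters S)) => [/pos->|_] //=; by rewrite orbF.
have [phi E] := word_surj Pm; exists phi.
have SE : state n.+1 (rev w) = S.
  apply: state_letters => //; apply/allP=> s sS; apply: Sn.
  by rewrite (perm_mem (perm_letters S)) mem_cat map_f.
rewrite /state_of E rev_cat state_above SE //.
have -> : (top n.+1 S).2 = 1.
  by move: h; case: (S).
rewrite all_rev; apply/allP=> u; rewrite mem_filter mem_iota => /andP[uNS /andP[u1 _]].
rewrite /= ltn_neqAle u1 andbT; apply: contraNneq uNS => <-.
rewrite (perm_mem (perm_letters S)) mem_cat; apply/orP; right.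
by move: h; case: (unzip2 S) => //= a s ->; rewrite mem_head.
Qed.

Theorem proposition3p40 (n : nat) (n_ge1 : 1 <= n) :
  #|Kclasses K_123_132__213_321 n| = \sum_(0 <= i < n) motzkin i.
Proof.
rewrite -size_motzkin_paths /Kclasses.
rewrite (@card_equivalence_partition _ _ _ (fun phi : 'S_n => code (state_of phi))); last first.
  move=> phi psi; rewrite Kequiv_state; apply/eqP/eqP => [->//|].
  have [P1 _] := state_of_proper phi n_ge1; have [P2 _] := state_of_proper psi n_ge1.
  exact: code_inj.
apply: perm_size; apply: uniq_perm; rewrite ?undup_uniq ?uniq_motzkin_paths //.
move=> p; rewrite mem_undup mem_motzkin_paths.
apply/mapP/andP => [[phi _ ->]|[mp szp]].
  by have [/code_motzkin-> ->] := state_of_proper phi n_ge1.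
have [S [PS cS Sn]] := code_surj mp.
have [phi E] : exists phi : 'S_n, state_of phi = S.
  by apply: state_of_surj => // u /Sn up; apply: (leq_trans up); rewrite addn2 ltnS.
by exists phi; rewrite ?mem_enum // E.
Qed.
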